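(* Let $\mathcal{M}$ be a type $\mathrm{I}_\infty$ factor, and let $\mathcal{B}\subseteq\mathcal{M}$ be a (unital) von Neumann subfactor of type $\mathrm{I}_\infty$. If $\mathcal{B}$ is regular in $\mathcal{M}$, then $\mathcal{B}$ is unitarily regular in $\mathcal{M}$.
   Context: For a unital inclusion of von Neumann algebras $\mathcal{B}\subseteq\mathcal{M}$ (i.e. $1_{\mathcal{B}}=1_{\mathcal{M}}$), put $\mathcal{N}_{\mathcal{M}}(\mathcal{B})=\{n\in\mathcal{M}: n\mathcal{B}n^*\cup n^*\mathcal{B}n\subseteq\mathcal{B}\}$ (the normaliser) and $\mathcal{UN}_{\mathcal{M}}(\mathcal{B})=\{u\in\mathcal{M}\text{ unitary}: u\mathcal{B}u^*=\mathcal{B}\}$ (the unitary normaliser). $W^*(S)$ denotes the von Neumann subalgebra of $\mathcal{M}$ generated by $S$. $\mathcal{B}$ is regular in $\mathcal{M}$ if $W^*(\mathcal{N}_{\mathcal{M}}(\mathcal{B}))=\mathcal{M}$ and unitarily regular in $\mathcal{M}$ if $W^*(\mathcal{UN}_{\mathcal{M}}(\mathcal{B}))=\mathcal{M}$. *)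

(* Defs.v *)
From HB Require Import structures.
From mathcomp Require Import all_boot all_order all_algebra.
From mathcomp Require Import complex.
From mathcomp Require Import all_classical all_reals all_analysis.

Set Implicit Arguments.
Unset Strict Implicit.
Unset Printing Implicit Defensive.

Import Order.TTheory GRing.Theory Num.Theory.
Import numFieldNormedType.Exports.

Local Open Scope classical_set_scope.
Local Open Scope ring_scope.
Local Open Scope complex_scope.

(* Complex Hilbert spaces of arbitrary dimension, not assumed separable; the
   inner product is linear in its first argument. *)
Record hilbertType (R : realType) := Hilbert {
  hilbert_sort :> completeNormedModType R[i] ;
  inner : {dot hilbert_sort for Num.conj} ;
  norm_inner : forall x : hilbert_sort, `|x| ^+ 2 = inner x x }.

Section VonNeumann.
Variables (R : realType) (H : hilbertType R).

(* Operators are plain functions H -> H; every algebra considered below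
   consists of bounded linear ones. *)
Definition bounded_operator (T : H -> H) : Prop :=
  linear T /\ exists k : R[i], forall x, `|T x| <= k * `|x|.

Definition is_adjoint (T S : H -> H) : Prop :=
  forall x y, inner H (T x) y = inner H x (S y).

(* An adjoint is unique when it exists, and exists for bounded operators; the
   default value 0 is only taken at operators without an adjoint. *)
Definition adjoint (T : H -> H) : H -> H :=
  xget (fun=> 0) [set S | is_adjoint T S].

Definition scalar_operator (c : R[i]) : H -> H := fun x => c *: x.

Definition commutant (S : set (H -> H)) : set (H -> H) :=
  [set T | bounded_operator T /\ forall a, S a -> T \o a = a \o T].

(* Von Neumann algebras act nondegenerately: the unit of M is the identity of
   H, so that an inclusion of von Neumann algebras on H is always unital. *)
Definition von_neumann_algebra (M : set (H -> H)) : Prop :=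
  (forall a, M a -> M (adjoint a)) /\ commutant (commutant M) = M.

Definition center (M : set (H -> H)) : set (H -> H) := M `&` commutant M.

Definition factor (M : set (H -> H)) : Prop :=
  von_neumann_algebra M /\ center M = range scalar_operator.

Definition projection (p : H -> H) : Prop :=
  [/\ bounded_operator p, p \o p = p & adjoint p = p].

Definition proj_le (p q : H -> H) : Prop := q \o p = p.

Definition abelian_projection (M : set (H -> H)) (p : H -> H) : Prop :=
  [/\ M p, projection p &
      forall a b, M a -> M b ->
        (p \o a \o p) \o (p \o b \o p) = (p \o b \o p) \o (p \o a \o p)].

Definition type_I (M : set (H -> H)) : Prop :=
  forall z, center M z -> projection z -> z <> (fun=> 0) ->
    exists p, [/\ abelian_projection M p, p <> (fun=> 0) & proj_le p z].

(* Murray-von Neumann equivalence relative to M. *)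
Definition equivalent_projections (M : set (H -> H)) (p q : H -> H) : Prop :=
  exists v, [/\ M v, adjoint v \o v = p & v \o adjoint v = q].

Definition finite_projection (M : set (H -> H)) (p : H -> H) : Prop :=
  forall q, M q -> projection q -> proj_le q p ->
    equivalent_projections M q p -> q = p.

(* For a factor, being infinite and being properly infinite are the same;
   infiniteness also rules out the zero algebra. *)
Definition type_I_infty_factor (M : set (H -> H)) : Prop :=
  [/\ factor M, type_I M & ~ finite_projection M idfun].

Definition unitary (u : H -> H) : Prop :=
  [/\ bounded_operator u, adjoint u \o u = idfun & u \o adjoint u = idfun].

Definition normaliser (M B : set (H -> H)) : set (H -> H) :=
  [set n | M n /\
     [set n \o b \o adjoint n | b in B] `|` [set adjoint n \o b \o n | b in B]
       `<=` B].

Definition unitary_normaliser (M B : set (H -> H)) : set (H -> H) :=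
  [set u | [/\ M u, unitary u & [set u \o b \o adjoint u | b in B] = B]].

(* W*(S): the smallest von Neumann subalgebra of M containing S. *)
Definition generated_vna (M S : set (H -> H)) : set (H -> H) :=
  [set T | M T /\
     forall N, von_neumann_algebra N -> N `<=` M -> S `<=` N -> N T].

Definition regular (M B : set (H -> H)) : Prop :=
  generated_vna M (normaliser M B) = M.

Definition unitarily_regular (M B : set (H -> H)) : Prop :=
  generated_vna M (unitary_normaliser M B) = M.

End VonNeumann.

(* Main.v *)
Require Import Defs.
From mathcomp Require Import all_boot all_order all_algebra.
From mathcomp Require Import complex ring lra.
From mathcomp Require Import all_classical all_reals all_analysis.

(** The conclusion rests on the splitting of [M] as [B] tensor [B' `&` M],
    which holds because [B] is a type I factor.  Unitaries of [B] normalise [B],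
    and unitaries of [M] commuting with [B] do so trivially, so both legs of the
    tensor product lie in the algebra generated by the unitary normaliser.

    To show that a von Neumann algebra containing the unitary normaliser contains
    [M], it is enough, by the double commutant property, that every bounded [T]
    commuting with the unitary normaliser commutes with [M].  Three ideas replace
    the tensor decomposition.

    - Cayley transforms ([cayley]).  For a self-adjoint [x] the unitary
      [(x - i) (x + i)^-1] has the same linear commutant as [x], so commuting
      with unitaries is enough to commute with self-adjoint operators, and no
      functional calculus is required.

    - Lifting from a corner ([unitary_lift]).  Let [e] be a nonzero projection of
      the factor [B].  The vectors [b e h] are total ([orbit_total]).  If a unitary
      [u] commutes with [e] and with [e B e], then the vectors [b e h] and
      [b u e h] have the same Gram matrix, so a unitary [y] sends the former to
      the latter ([gram_unitary]); it commutes with [B] and [y e = u e].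

    - Abelian corners are scalar ([commutes_corner]).  When [e] is abelian, the
      Cayley transform of a self-adjoint element of [e B e] lifts to a unitary
      which is central in [B], hence a scalar.  Anything commuting with [e]
      therefore commutes with [e B e].

    Now let [e] be an abelian projection of [B].  By the last point, the Cayley
    transform of a self-adjoint element of [e M e] satisfies the hypotheses of the
    lifting lemma; the lift is a unitary of [M] commuting with [B], so [T]
    commutes with it, and therefore with [e M e].  Together with [B], the corner
    [e M e] controls all of [M], by totality of the vectors [b e h]
    ([commutes_of_corner]).

    Every Hilbert space construction used (adjoints, orthogonal projections,
    resolvents, the operator of [gram_unitary]) is an instance of one Riesz
    representation theorem, stated for linear relations ([riesz_relation]). *)

Set Implicit Arguments.
Unset Strict Implicit.
Unset Printing Implicit Defensive.

Import Order.TTheory GRing.Theory Num.Theory.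
Import numFieldNormedType.Exports.

Local Open Scope classical_set_scope.
Local Open Scope ring_scope.
Local Open Scope complex_scope.

(** * Inner products and the Riesz representation theorem *)

Section Hilbert.
Variables (R : realType) (H : hilbertType R).
Implicit Types (x y z w : H) (c : R[i]).

Local Notation "''[' x , y ]" := (inner H x y) : ring_scope.
Local Notation conj := Num.conj.
Local Notation i := ('i%C : R[i]).
Local Notation Re := (@complex.Re R).

Lemma innerDl x y z : '[x + y, z] = '[x, z] + '[y, z].
Proof. exact: linearDl. Qed.
Lemma innerDr x y z : '[z, x + y] = '[z, x] + '[z, y].
Proof. exact: linearDr. Qed.
Lemma innerZl c x y : '[c *: x, y] = c * '[x, y].
Proof. exact: linearZl_LR. Qed.
Lemma innerZr c x y : '[x, c *: y] = conj c * '[x, y].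
Proof. exact: linearZr_LR. Qed.
Lemma innerNl x y : '[- x, y] = - '[x, y].
Proof. by rewrite -scaleN1r innerZl mulN1r. Qed.
Lemma innerNr x y : '[x, - y] = - '[x, y].
Proof. by rewrite -scaleN1r innerZr rmorphN1 mulN1r. Qed.
Lemma inner0l y : '[0, y] = 0.
Proof. by rewrite -(scale0r 0) innerZl mul0r. Qed.
Lemma inner0r x : '[x, 0] = 0.
Proof. by rewrite -(scale0r 0) innerZr rmorph0 mul0r. Qed.
Lemma innerC x y : '[y, x] = conj '[x, y].
Proof. by rewrite hermC /= expr0 mul1r. Qed.

Definition innerE := (innerDl, innerDr, innerNl, innerNr, innerZl, innerZr).

Lemma conj_i : conj i = - i :> R[i].
Proof. by apply/eqP; rewrite eq_complex /= oppr0 !eqxx. Qed.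

Lemma mulii : i * i = -1 :> R[i].
Proof. by apply/eqP; rewrite eq_complex /= !mul0r !mulr0 mul1r sub0r addr0 oppr0 !eqxx. Qed.

Lemma i_neq0 : i != 0 :> R[i].
Proof. by apply/eqP => -[/eqP]; rewrite oner_eq0. Qed.

(** The squared norm as an element of [R]: the norm of [H] takes its values in
    [R[i]], whose order is only partial. *)
Definition sq x : R := Re '[x, x].

Lemma inner_sq x : '[x, x] = (sq x)%:C.
Proof.
by rewrite /sq; apply/esym/RRe_real; rewrite ger0_real // dnorm_ge0.
Qed.

Lemma sq_ge0 x : 0 <= sq x.
Proof. by rewrite -ler0c -inner_sq dnorm_ge0. Qed.

Lemma inner_eq0 x : '[x, x] = 0 -> x = 0.
Proof. by move/eqP; rewrite dnorm_eq0 => /eqP. Qed.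

Lemma sq_eq0 x : sq x = 0 -> x = 0.
Proof. by move=> x0; apply: inner_eq0; rewrite inner_sq x0. Qed.

Lemma ReD (a b : R[i]) : Re (a + b) = Re a + Re b.
Proof. by case: a b => [? ?] []. Qed.
Lemma ReN (a : R[i]) : Re (- a) = - Re a.
Proof. by case: a. Qed.
Lemma ReJ (a : R[i]) : Re (conj a) = Re a.
Proof. by case: a. Qed.
Lemma ReZ (r : R) (a : R[i]) : Re (r%:C * a) = r * Re a.
Proof. by case: a => a b /=; rewrite mul0r subr0. Qed.
Lemma conjR (r : R) : conj (r%:C) = r%:C :> R[i].
Proof. by apply/eqP; rewrite eq_complex /= oppr0 !eqxx. Qed.
(** Lifts identities proved for real parts only to complex identities. *)
Lemma eq_Re (a b : R[i]) : Re a = Re b -> Re (i * a) = Re (i * b) -> a = b.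
Proof.
case: a b => a1 a2 [b1 b2] /= ->; rewrite !mul0r !mul1r !sub0r.
by move=> /oppr_inj ->.
Qed.

Lemma ReC x y : Re '[y, x] = Re '[x, y].
Proof. by rewrite innerC ReJ. Qed.

Lemma sqD x y : sq (x + y) = sq x + sq y + 2 * Re '[x, y].
Proof. by rewrite /sq !innerE !ReD (ReC x y); ring. Qed.
Lemma sqN x : sq (- x) = sq x.
Proof. by rewrite /sq !innerE opprK. Qed.
Lemma sqB x y : sq (x - y) = sq x + sq y - 2 * Re '[x, y].
Proof. by rewrite sqD sqN innerNr ReN; ring. Qed.
Lemma sqZ (r : R) x : sq (r%:C *: x) = r ^+ 2 * sq x.
Proof. by rewrite /sq !innerE conjR !ReZ; ring. Qed.

Lemma cauchy_schwarz x y : Re '[x, y] ^+ 2 <= sq x * sq y.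
Proof.
have [y0|y0] := eqVneq (sq y) 0.
  by rewrite (sq_eq0 y0) inner0r expr0n /= mulr_ge0 ?sq_ge0.
have yp : 0 < sq y by rewrite lt_neqAle eq_sym y0 sq_ge0.
have := sq_ge0 (x + (- (Re '[x, y] / sq y))%:C *: y).
rewrite sqD sqZ innerZr conjR ReZ.
set r := Re '[x, y].
have -> : sq x + (- (r / sq y)) ^+ 2 * sq y + 2 * (- (r / sq y) * r) =
          sq x - r ^+ 2 / sq y by field.
by rewrite subr_ge0 ler_pdivrMr.
Qed.

(** The multiplicative form in which all limits below are taken. *)
Lemma eq0_of_small (a b : R) :
  0 <= b -> (forall e, 0 < e -> a ^+ 2 <= e * b) -> a = 0.
Proof.
move=> b0 h; apply/eqP; rewrite -(sqrf_eq0 a) eq_le sqr_ge0 andbT.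
have [b00|bn] := eqVneq b 0; first by have := h 1 ltr01; rewrite b00 mulr0.
have bp : 0 < b by rewrite lt_neqAle eq_sym bn.
apply/ler_addgt0Pr => e e0; rewrite add0r.
by have := h (e / b) (divr_gt0 e0 bp); rewrite divfK.
Qed.

Lemma norm_sq x : `|x| ^+ 2 = (sq x)%:C.
Proof. by rewrite norm_inner inner_sq. Qed.

Lemma norm_lt x (e : R) : 0 < e -> sq x < e ^+ 2 -> `|x| < e%:C.
Proof.
move=> e0 h; rewrite -(@ltr_pXn2r _ 2) ?nnegrE ?ler0c ?(ltW e0)//.
by rewrite norm_sq -rmorphXn /= ltcR.
Qed.

Lemma sq_lt x (e : R) : `|x| < e%:C -> sq x < e ^+ 2.
Proof.
move=> h; have e0 : 0 <= e%:C :> R[i] by apply: ltW; apply: le_lt_trans h.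
by rewrite -ltcR rmorphXn /= -norm_sq ltr_pXn2r ?nnegrE.
Qed.

Lemma sq_complete (u : nat -> H) :
  (forall e : R, 0 < e -> exists N, forall m n, (N <= m)%N -> (N <= n)%N ->
     sq (u m - u n) < e) ->
  exists w, forall e : R, 0 < e -> exists N, forall n, (N <= n)%N -> sq (w - u n) < e.
Proof.
move=> cu.
have uC : cvg (u @ \oo).
  apply: cauchy_cvg; apply: cauchy_exP => e e0.
  have er : e \is Num.real by rewrite gtr0_real.
  have E : e = (Re e)%:C by rewrite RRe_real.
  have r0 : 0 < Re e by rewrite -ltcR -E.
  have [N hN] := cu _ (exprn_gt0 2 r0).
  exists (u N); exists N => // n /= Nn.
  by rewrite -ball_normE /= E norm_lt// hN.
exists (lim (u @ \oo)) => e e0.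
have /cvgrPdist_lt/(_ (Num.sqrt e)%:C) := uC.
rewrite ltcR sqrtr_gt0 => /(_ e0) [N _ hN]; exists N => n Nn.
by have := sq_lt (hN n Nn); rewrite sqr_sqrtr // ltW.
Qed.

Lemma young_below (a s k : R) : 0 <= k -> 0 <= s -> a ^+ 2 <= k * s -> - k <= s - 2 * a.
Proof.
move=> k0 s0 h.
have : a <= (s + k) / 2.
  rewrite leNgt; apply/negP => lt; have := sqr_ge0 (s - k); nra.
lra.
Qed.

Lemma parallelogram_small (a b x y p d e hm hn : R) :
  x - 2 * a < d + hm -> y - 2 * b < d + hn ->
  d <= 2^-1 ^+ 2 * (x + y + 2 * p) - 2 * (2^-1 * (a + b)) ->
  hm < e / 4 -> hn < e / 4 -> x + y - 2 * p < e.
Proof. by rewrite expr2; lra. Qed.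

Lemma sqr_triangle (X Y A e s : R) :
  (Y - A) ^+ 2 <= e * s -> (X - Y) ^+ 2 <= e * s -> (X - A) ^+ 2 <= e * (4 * s).
Proof. by move=> h1 h2; have := sqr_ge0 ((X - Y) - (Y - A)); nra. Qed.

(** A discriminant estimate; it also has to cover the degenerate case [s = 0]. *)
Lemma variation_bound (q s e : R) : 0 <= s -> 0 < e ->
  (forall r, 0 <= r ^+ 2 * s + 2 * r * q + e) -> q ^+ 2 <= e * s.
Proof.
move=> s0 e0 var.
have [s1|s1] := eqVneq s 0.
  rewrite s1 mulr0; have [->|q0] := eqVneq q 0; first by rewrite expr0n.
  have := var (- e / q); rewrite s1.
  have -> : (- e / q) ^+ 2 * 0 + 2 * (- e / q) * q + e = - e by field.
  by rewrite oppr_ge0 leNgt e0.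
have sp : 0 < s by rewrite lt_neqAle eq_sym s1.
have := var (- q / s).
have -> : (- q / s) ^+ 2 * s + 2 * (- q / s) * q + e = e - q ^+ 2 / s by field.
by rewrite subr_ge0 ler_pdivrMr.
Qed.

(** The relation [D] is the graph of a bounded functional on a subspace that need
    not be closed; the bound makes [a] depend on [s] only.  A minimising sequence
    for [sq s - 2 Re a] is Cauchy by the parallelogram law, and stationarity of
    its limit [w] gives the representation.  As a limit of the domain, [w] is
    orthogonal to whatever the domain is orthogonal to. *)
Lemma riesz_relation (D : H -> R[i] -> Prop) (k : R) :
  0 <= k ->
  D 0 0 ->
  (forall s a t b, D s a -> D t b -> D (s + t) (a + b)) ->
  (forall c s a, D s a -> D (c *: s) (c * a)) ->
  (forall s a, D s a -> Re a ^+ 2 <= k * sq s) ->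
  exists w, [/\ forall s a, D s a -> '[s, w] = a,
                sq w <= k &
                forall v, (forall s a, D s a -> '[s, v] = 0) -> '[w, v] = 0].
Proof.
move=> k0 D0 DD DZ Dk.
pose phi s a : R := sq s - 2 * Re a.
pose V := [set r | exists s a, D s a /\ r = phi s a].
have phik s a : D s a -> - k <= phi s a.
  by move=> /Dk; apply: young_below => //; exact: sq_ge0.
have hi : has_inf V.
  split; first by exists (phi 0 0); exists 0, 0.
  by exists (- k) => _ [s [a [sa ->]]]; exact: phik.
set d := inf V.
have dphi s a : D s a -> d <= phi s a.
  by move=> sa; apply: ge_inf; [exact: hi.2 | exists s, a].
have /choice[u hu] n : exists p : H * R[i], D p.1 p.2 /\ phi p.1 p.2 < d + n.+1%:R^-1.
  have [|_ [s [a [sa ->]]] lt] := @inf_adherent _ V n.+1%:R^-1 _ hi.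
    by rewrite invr_gt0.
  by exists (s, a).
have inv e : 0 < e -> exists N, forall n, (N <= n)%N -> n.+1%:R^-1 < e :> R.
  move=> e0; have [N _ hN] := near_infty_natSinv_lt (PosNum e0).
  by exists N => n; exact: hN.
have [|w hw] := @sq_complete (fun n => (u n).1).
  move=> e e0; have [|N hN] := inv (e / 4); first by rewrite divr_gt0.
  exists N => m n /hN hm /hN hn.
  have [Dm pm] := hu m; have [Dn pn] := hu n.
  have := dphi _ _ (DZ (2^-1)%:C _ _ (DD _ _ _ _ Dm Dn)).
  move: pm pn; rewrite /phi sqZ ReZ ReD sqD sqB => h1 h2 h3.
  exact: (parallelogram_small h1 h2 h3 hm hn).
have near e : 0 < e -> exists n, sq (w - (u n).1) < e /\ phi (u n).1 (u n).2 < d + e.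
  move=> e0; have [N hN] := hw _ e0; have [N' hN'] := inv _ e0.
  exists (maxn N N'); split; first by rewrite hN ?leq_maxl.
  apply: lt_trans (proj2 (hu _)) _; rewrite ltrD2l hN' ?leq_maxr//.
(* Perturbing the almost minimiser p by r s, for real r, gives a quadratic in r
   that is nonnegative; its discriminant bounds the defect of p at s. *)
have wRe s a : D s a -> Re '[s, w] = Re a.
  move=> sa; apply/eqP; rewrite -subr_eq0; apply/eqP.
  apply: (@eq0_of_small _ (4 * sq s)) => [|e e0]; first by rewrite mulr_ge0 ?sq_ge0.
  have [n [h1 h2]] := near _ e0.
  have [Dn _] := hu n.
  set p := (u n).1 in h1 h2 Dn; set b := (u n).2 in h2 Dn.
  have g1 : (Re '[p, s] - Re a) ^+ 2 <= e * sq s.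
    have var r : 0 <= r ^+ 2 * sq s + 2 * r * (Re '[p, s] - Re a) + e.
      have := dphi _ _ (DD _ _ _ _ Dn (DZ r%:C _ _ sa)).
      by move: h2; rewrite /phi sqD sqZ innerZr conjR ReD !ReZ; lra.
    exact: variation_bound (sq_ge0 s) e0 var.
  have g2 := cauchy_schwarz (w - p) s.
  have g3 : sq (w - p) * sq s <= e * sq s by rewrite ler_wpM2r ?sq_ge0 ?ltW.
  move: g2; rewrite innerDl innerNl ReD ReN (ReC s w) => g2.
  move: g1 g2; set X := Re '[s, w]; set Y := Re '[p, s] => g1 g2.
  exact: (sqr_triangle g1 (le_trans g2 g3)).
exists w; split.
- move=> s a sa; apply: eq_Re; first exact: wRe.
  by rewrite -innerZl; apply: wRe; apply: DZ.
- apply/ler_addgt0Pr => e e0.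
  have [n [h1 _]] := near _ e0; have [Dn _] := hu n.
  have := phik _ _ Dn; rewrite /phi -(wRe _ _ Dn).
  by move: h1; rewrite sqB (ReC _ w); lra.
- move=> v hv.
  have hRe v' : (forall s a, D s a -> '[s, v'] = 0) -> Re '[w, v'] = 0.
    move=> h; apply: (@eq0_of_small _ (sq v')) => [|e e0]; first exact: sq_ge0.
    have [n [h1 _]] := near _ e0; have [Dn _] := hu n.
    have := cauchy_schwarz (w - (u n).1) v'.
    rewrite innerDl innerNl (h _ _ Dn) subr0 => /le_trans; apply.
    by rewrite ler_wpM2r ?sq_ge0 ?ltW.
  apply: eq_Re; first by rewrite hRe.
  have -> : i * '[w, v] = '[w, - i *: v] by rewrite innerZr rmorphN /= conj_i opprK.
  rewrite mulr0 hRe// => s a sa.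
  by rewrite innerZr (hv _ _ sa) mulr0.
Qed.

End Hilbert.

(** * Bounded operators and their adjoints *)

Section Operators.
Variables (R : realType) (H : hilbertType R).
Implicit Types (x y z w h : H) (c : R[i]) (T S F G u e : H -> H).

Local Notation "''[' x , y ]" := (inner H x y) : ring_scope.
Local Notation conj := Num.conj.
Local Notation i := ('i%C : R[i]).
Local Notation Re := (@complex.Re R).

Lemma linD T x y : linear T -> T (x + y) = T x + T y.
Proof. by move=> lT; have := lT 1 x y; rewrite !scale1r. Qed.
Lemma lin0 T : linear T -> T 0 = 0.
Proof. by move=> lT; have := lT (-1) 0 0; rewrite !scaleN1r !addNr. Qed.
Lemma linZ T c x : linear T -> T (c *: x) = c *: T x.
Proof. by move=> lT; have := lT c x 0; rewrite (lin0 lT) !addr0. Qed.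
Lemma linN T x : linear T -> T (- x) = - T x.
Proof. by move=> lT; rewrite -scaleN1r linZ// scaleN1r. Qed.
Lemma linB T x y : linear T -> T (x - y) = T x - T y.
Proof. by move=> lT; rewrite linD// linN. Qed.

Lemma eq_inner x y : (forall z, '[z, x] = '[z, y]) -> x = y.
Proof.
move=> h; apply/eqP; rewrite -subr_eq0; apply/eqP; apply: inner_eq0.
by rewrite innerDr innerNr h subrr.
Qed.

Lemma boundedP T : bounded_operator T <->
  linear T /\ exists2 k : R, 0 <= k & forall x, sq (T x) <= k * sq x.
Proof.
split=> -[lT [k]].
- move=> hk; split=> //.
  have [K KE] : exists K : R, K%:C = `|k| ^+ 2.
    by exists (Re (`|k| ^+ 2)); rewrite RRe_real// ger0_real// exprn_ge0.
  exists K; first by rewrite -ler0c KE exprn_ge0.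
  move=> x; rewrite -lecR rmorphM /= -!norm_sq KE.
  rewrite -exprMn ler_pXn2r ?nnegrE ?mulr_ge0//.
  have := hk x; have -> : `|k| * `|x| = `|k * `|x| | by rewrite normrM normr_id.
  by move=> h; rewrite ger0_norm//; apply: le_trans h.
- move=> k0 hk; split=> //; exists (Num.sqrt k)%:C => x.
  rewrite -(@ler_pXn2r _ 2) ?nnegrE ?mulr_ge0 ?ler0c ?sqrtr_ge0//.
  by rewrite exprMn !norm_sq -rmorphXn /= sqr_sqrtr// -rmorphM /= lecR.
Qed.

Lemma bounded_lin T : bounded_operator T -> linear T.
Proof. by case. Qed.

Lemma bounded_of_sq_le T : linear T -> (forall x, sq (T x) <= sq x) -> bounded_operator T.
Proof. by move=> lT h; apply/boundedP; split=> //; exists 1 => // x; rewrite mul1r. Qed.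

Lemma bounded_comp T S : bounded_operator T -> bounded_operator S -> bounded_operator (T \o S).
Proof.
move=> /boundedP[lT [k k0 hk]] /boundedP[lS [l l0 hl]]; apply/boundedP; split.
  by move=> c x y /=; rewrite lS lT.
exists (k * l); first exact: mulr_ge0.
by move=> x; apply: le_trans (hk _) _; rewrite -mulrA ler_wpM2l.
Qed.

Lemma bounded_scale_add T S c : bounded_operator T -> bounded_operator S ->
  bounded_operator (fun x => c *: T x + S x).
Proof.
move=> [lT [k hk]] [lS [l hl]]; split.
  move=> a x y; rewrite lT lS !scalerDr !scalerA [c * a]mulrC.
  by rewrite -!addrA; congr (_ + _); rewrite addrCA.
exists (`|c| * k + l) => x; apply: le_trans (ler_normD _ _) _.
by rewrite mulrDl lerD// normrZ -mulrA ler_wpM2l.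
Qed.

Lemma adjoint_ex T : bounded_operator T -> exists S, is_adjoint T S.
Proof.
move=> /boundedP[lT [k k0 hk]].
suff /choice[S hS] y : exists w, forall x, '[T x, y] = '[x, w] by exists S => x y.
have [||||s a ->|w [hw _ _]] := @riesz_relation _ _ (fun s a => a = '[T s, y]) (k * sq y).
- by rewrite mulr_ge0 ?sq_ge0.
- by rewrite (lin0 lT) inner0l.
- by move=> s a t b -> ->; rewrite (linD _ _ lT) innerDl.
- by move=> c s a ->; rewrite (linZ _ _ lT) innerZl.
- apply: le_trans (cauchy_schwarz _ _) _.
  by rewrite mulrAC ler_wpM2r ?sq_ge0.
- by exists w => x; rewrite (hw _ _ erefl).
Qed.

Lemma adjoint_unique T S : is_adjoint T S -> adjoint T = S.
Proof.
move=> h; apply/funext => y; apply: eq_inner => z.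
have : is_adjoint T (adjoint T) by rewrite /adjoint; apply: xgetPex; exists S.
by move=> /(_ z y) <-.
Qed.

Lemma adjointP T : bounded_operator T -> is_adjoint T (adjoint T).
Proof. by move=> /adjoint_ex[S hS]; rewrite (adjoint_unique hS). Qed.

Lemma adjoint_swap T S : is_adjoint T S -> forall x y, '[S x, y] = '[x, T y].
Proof. by move=> h x y; rewrite innerC -h -innerC. Qed.

Lemma adjoint_bounded T : bounded_operator T -> bounded_operator (adjoint T).
Proof.
move=> bT; have hT := adjointP bT; have hS := adjoint_swap hT.
move: bT => /boundedP[lT [k k0 hk]]; apply/boundedP; split.
  by move=> c x y; apply: eq_inner => z; rewrite -hT !innerE -!hT.
exists k => // x.
have [->|n0] := eqVneq (sq (adjoint T x)) 0; first by rewrite mulr_ge0 ?sq_ge0.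
have p : 0 < sq (adjoint T x) by rewrite lt_neqAle eq_sym n0 sq_ge0.
rewrite -(ler_pM2l p) -expr2 {1}/sq -hT.
apply: le_trans (cauchy_schwarz _ _) _.
by rewrite mulrA ler_wpM2r ?sq_ge0// mulrC.
Qed.

Lemma projection_sa e : projection e -> is_adjoint e e.
Proof. by case=> be _ ae; have := adjointP be; rewrite ae. Qed.

Lemma projection_idem e x : projection e -> e (e x) = e x.
Proof. by case=> _ ee _; rewrite -[LHS]/((e \o e) x) ee. Qed.

Lemma unitary_of_adjoint u (v : H -> H) : bounded_operator u -> is_adjoint u v ->
  cancel u v -> cancel v u -> unitary u.
Proof.
by move=> bu hu uv vu; split=> //; rewrite (adjoint_unique hu); apply/funext.
Qed.

Lemma unitaryK u : unitary u -> cancel u (adjoint u).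
Proof. by case=> _ h _ x; rewrite -[LHS]/((adjoint u \o u) x) h. Qed.
Lemma unitaryVK u : unitary u -> cancel (adjoint u) u.
Proof. by case=> _ _ h x; rewrite -[LHS]/((u \o adjoint u) x) h. Qed.
Lemma unitary_inner u x y : unitary u -> '[u x, u y] = '[x, y].
Proof. by move=> hu; case: (hu) => bu _ _; rewrite (adjointP bu) unitaryK. Qed.

Definition commutes T S := forall x, T (S x) = S (T x).

Lemma commutes_sym T S : commutes T S -> commutes S T.
Proof. by move=> h x; rewrite h. Qed.

Lemma commutes_adjoint T S : bounded_operator T -> bounded_operator S ->
  commutes T S -> commutes (adjoint T) (adjoint S).
Proof.
move=> bT bS h x; apply: eq_inner => z.
by rewrite -(adjointP bT) -!(adjointP bS) -(adjointP bT) h.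
Qed.

Lemma commutantP (A : set (H -> H)) T :
  commutant A T <-> bounded_operator T /\ forall a, A a -> commutes T a.
Proof.
split=> -[bT h]; split=> // a Aa; first by move=> x; have := h a Aa => /funeqP/(_ x).
by apply/funext => x; exact: h.
Qed.

(** * Closure properties of von Neumann algebras *)

Section VonNeumannAlgebra.
Variables (A : set (H -> H)) (hA : von_neumann_algebra A).

(** The double commutant property, in the form used to prove membership. *)
Lemma vnaP (a : H -> H) : A a <->
  bounded_operator a /\ forall T, commutant A T -> commutes T a.
Proof.
rewrite -[A in A a]hA.2 commutantP; split=> -[ba h].
  by split=> // T hT; apply: commutes_sym; apply: h.
by split=> // T hT; apply: commutes_sym; apply: h.
Qed.

Lemma vna_bounded a : A a -> bounded_operator a.
Proof. by move=> /vnaP[]. Qed.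

Lemma vna_adjoint a : A a -> A (adjoint a).
Proof. exact: hA.1. Qed.

Lemma vna_comp a b : A a -> A b -> A (a \o b).
Proof.
move=> Aa Ab; apply/vnaP; split; first by apply: bounded_comp; apply: vna_bounded.
by move=> T /commutantP[_ hT] x /=; rewrite (hT _ Aa) (hT _ Ab).
Qed.

Lemma vna_scale_add c a b : A a -> A b -> A (fun x => c *: a x + b x).
Proof.
move=> Aa Ab; apply/vnaP; split; first by apply: bounded_scale_add; apply: vna_bounded.
by move=> T /commutantP[[lT _] hT] x; rewrite lT (hT _ Aa) (hT _ Ab).
Qed.

Lemma vna_id : A idfun.
Proof. by apply/vnaP; split=> //; apply: bounded_of_sq_le. Qed.

Lemma sa_decomposition a : A a -> exists a1 a2,
  [/\ A a1, A a2, is_adjoint a1 a1, is_adjoint a2 a2 &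
      forall x, a x = a1 x + i *: a2 x].
Proof.
move=> Aa; have Ab := vna_adjoint Aa; set b := adjoint a in Ab.
have hab : is_adjoint a b by apply: adjointP; apply: vna_bounded.
have hba := adjoint_swap hab.
have A0 : A (fun=> 0).
  have := vna_scale_add (-1) vna_id vna_id; congr A.
  by apply/funext => x /=; rewrite scaleN1r addNr.
have AZ c f : A f -> A (fun x => c *: f x).
  move=> Af; have := vna_scale_add c Af A0; congr A.
  by apply/funext => x /=; rewrite addr0.
exists (fun x => 2^-1 *: (1 *: a x + b x)), (fun x => (- i / 2) *: (-1 *: b x + a x)).
have c2 : conj (2^-1 : R[i]) = 2^-1 by rewrite fmorphV rmorph_nat.
have ci : conj (- i / 2) = i / 2 :> R[i] by rewrite rmorphM /= rmorphN /= conj_i opprK c2.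
split.
- exact/AZ/vna_scale_add.
- exact/AZ/vna_scale_add.
- by move=> x y; rewrite !scale1r !innerE c2 hab hba addrC.
- move=> x y; rewrite !scaleN1r !innerE ci hab hba; ring.
- move=> x; rewrite scale1r scaleN1r scalerA.
  have -> : i * (- i / 2) = 2^-1 by rewrite mulrA mulrN mulii opprK mul1r.
  rewrite -scalerDr addrA addrK -mulr2n -(scaler_nat 2 (a x)) scalerA.
  by rewrite mulVf ?scale1r// pnatr_eq0.
Qed.

(** Properties stable under [a1 + i a2] need only be checked on self-adjoint
    elements, by splitting into real and imaginary parts. *)
Lemma vna_ind (P : (H -> H) -> Prop) :
  (forall a, A a -> is_adjoint a a -> P a) ->
  (forall a1 a2, A a1 -> A a2 -> P a1 -> P a2 -> P (fun x => a1 x + i *: a2 x)) ->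
  forall a, A a -> P a.
Proof.
move=> Psa PD a /sa_decomposition[a1 [a2 [A1 A2 s1 s2 h]]].
by rewrite (funext h); apply: PD => //; apply: Psa.
Qed.

Lemma commutant_adjoint T : commutant A T -> commutant A (adjoint T).
Proof.
move=> /commutantP[bT hT]; apply/commutantP; split; first exact: adjoint_bounded.
move=> a Aa; have Aa' := vna_adjoint Aa.
have := commutes_adjoint bT (vna_bounded Aa') (hT _ Aa').
have -> // : adjoint (adjoint a) = a.
by apply: adjoint_unique; apply: adjoint_swap; apply: adjointP; apply: vna_bounded.
Qed.

End VonNeumannAlgebra.

(** * Cayley transforms *)

(** The hypotheses on [j] say that it is [i] or [- i]; the cross terms cancel
    because [<x h, h>] is real. *)
Lemma sq_resolvent (x : H -> H) (j : R[i]) h :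
  is_adjoint x x -> conj j = - j -> j * conj j = 1 ->
  sq (x h + j *: h) = sq (x h) + sq h.
Proof.
move=> sx cj jj; rewrite sqD /sq !innerE mulrA jj mul1r.
suff -> : Re (conj j * '[x h, h]) = 0 by rewrite mulr0 addr0.
have : Re (conj j * '[x h, h]) = - Re (conj j * '[x h, h]).
  by rewrite -{1}ReJ rmorphM /= -innerC -sx cj rmorphN /= cj opprK mulNr ReN opprK.
by lra.
Qed.

(** Represents the functional [(x + conj j) s |-> <s, h>], which is bounded because
    [x + conj j] does not decrease norms. *)
Lemma resolvent_ex (x : H -> H) (j : R[i]) h : bounded_operator x -> is_adjoint x x ->
  conj j = - j -> j * conj j = 1 -> exists y, x y + j *: y = h.
Proof.
move=> bx sx cj jj; have lx := bounded_lin bx.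
have cj' : conj (conj j) = - conj j by rewrite cj rmorphN /= cj.
have jj' : conj j * conj (conj j) = 1 by rewrite cj rmorphN /= cj opprK mulNr -mulrN -cj.
have [|||||w [hw _ _]] := @riesz_relation _ H
  (fun t a => exists2 s, t = x s + conj j *: s & a = '[s, h]) (sq h).
- exact: sq_ge0.
- by exists 0; rewrite ?(lin0 lx) ?scaler0 ?addr0 ?inner0l.
- move=> _ _ _ _ [s -> ->] [t -> ->]; exists (s + t); last by rewrite innerDl.
  by rewrite (linD _ _ lx) scalerDr addrACA.
- move=> c _ _ [s -> ->]; exists (c *: s); last by rewrite innerZl.
  by rewrite (linZ _ _ lx) scalerDr !scalerA mulrC.
- move=> _ _ [s -> ->]; rewrite sq_resolvent//; apply: le_trans (cauchy_schwarz _ _) _.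
  by rewrite mulrC ler_wpM2l ?sq_ge0// lerDr sq_ge0.
exists w; apply: eq_inner => z.
by have := hw _ _ (ex_intro2 _ _ z erefl erefl); rewrite !innerE sx.
Qed.

(** The unitary is [c = (x - i) (x + i)^-1 = 1 - 2 i (x + i)^-1], so commuting with
    [c], with the resolvent and with [x] are the same.  It makes unitaries enough
    to test commutation with a self-adjoint operator. *)
Lemma cayley (x : H -> H) : bounded_operator x -> is_adjoint x x -> exists c : H -> H,
  [/\ unitary c, forall T, linear T -> (commutes T c <-> commutes T x) &
      forall h, x h = 0 -> c h = - h].
Proof.
move=> bx sx; have lx := bounded_lin bx.
have ii : i * conj i = 1 :> R[i] by rewrite conj_i mulrN mulii opprK.
have cN : conj (- i) = - - i :> R[i] by rewrite rmorphN /= conj_i.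
have nn : - i * conj (- i) = 1 :> R[i] by rewrite cN opprK mulNr mulii opprK.
have /choice[r hr] h : exists y, x y + i *: y = h.
  by apply: resolvent_ex => //; exact: conj_i.
have /choice[r' hr'] h : exists y, x y + - i *: y = h by exact: resolvent_ex.
have inj (j : R[i]) y z : conj j = - j -> j * conj j = 1 ->
    x y + j *: y = x z + j *: z -> y = z.
  move=> cj jj e; apply/eqP; rewrite -subr_eq0; apply/eqP; apply: sq_eq0.
  have : sq (x (y - z) + j *: (y - z)) = 0.
    by rewrite (linB _ _ lx) scalerBr addrACA e -opprD subrr /sq inner0l.
  rewrite sq_resolvent// => /eqP; rewrite paddr_eq0 ?sq_ge0//.
  by move=> /andP[_ /eqP].
have rK y : r (x y + i *: y) = y.
  by apply: (inj i _ _ (conj_i R) ii); rewrite hr.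
have r'K y : r' (x y + - i *: y) = y by apply: (inj (- i)); rewrite ?hr'.
have lr : linear r.
  move=> a y z; apply: (inj i _ _ (conj_i R) ii).
  rewrite hr lx !scalerDr !scalerA addrACA -[i * a]mulrC -scalerA -scalerDr.
  by rewrite !hr.
(* r and r' are the resolvents of x at -i and i. *)
pose c := fun h => x (r h) + - i *: r h.
pose c' := fun h => x (r' h) + i *: r' h.
have cE (h : H) : c h = h - (2 * i) *: r h.
  rewrite /c -[X in _ = X - _](hr h) -addrA; congr (_ + _).
  by rewrite -scalerBl; congr (_ *: _); ring.
have lc : linear c.
  move=> a y z; rewrite /c lr lx !scalerDr !scalerA addrACA; congr (_ + _).
  by rewrite mulrC.
have bc : bounded_operator c.
  apply: bounded_of_sq_le => // h; rewrite -[X in _ <= sq X](hr h) !sq_resolvent//.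
  exact: conj_i.
have cc' : cancel c' c by move=> h; rewrite /c /c' rK hr'.
have c'c : cancel c c' by move=> h; rewrite /c /c' r'K hr.
have ac : is_adjoint c c'.
  move=> h k; rewrite -(cc' k) c'c; move: (c' k) => {}k.
  rewrite -[X in _ = '[X, _]](hr h) -[X in _ = '[_, X]](hr k) /c !innerE !cN conj_i !sx.
  ring.
exists c; split; first exact: unitary_of_adjoint ac c'c cc'.
- move=> T lT; split=> hT.
    have i2 : 2 * i != 0 :> R[i] by rewrite mulf_neq0 ?i_neq0// pnatr_eq0.
    have Tr h : T (r h) = r (T h).
      have := hT h; rewrite !cE (linB _ _ lT) (linZ _ _ lT) => /addrI/oppr_inj.
      exact: scalerI.
    move=> y; have e := Tr (x y + i *: y); rewrite rK in e.
    have := hr (T (x y + i *: y)); rewrite -e (linD _ _ lT) (linZ _ _ lT).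
    by move=> /addIr ->.
  have Tr h : T (r h) = r (T h).
    by apply: (inj i _ _ (conj_i R) ii); rewrite hr -hT -(linZ _ _ lT) -(linD _ _ lT) hr.
  by move=> h; rewrite /c (linD _ _ lT) (linZ _ _ lT) hT Tr.
- move=> h xh; have rh : r h = - i *: h.
    apply: (inj i _ _ (conj_i R) ii); rewrite hr (linZ _ _ lx) xh scaler0 add0r scalerA.
    by rewrite mulrN mulii opprK scale1r.
  rewrite cE rh scalerA -mulrA mulrN mulii opprK mulr1 scaler_nat mulr2n.
  by rewrite opprD addrA subrr sub0r.
Qed.

(** * Unitaries from Gram matrices *)

Section Total.
Variable I : Type.

Definition total_family (f : I -> H) := forall w, (forall k, '[f k, w] = 0) -> w = 0.

Lemma total_ext (f : I -> H) F G : total_family f ->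
  bounded_operator F -> bounded_operator G ->
  (forall k, F (f k) = G (f k)) -> F =1 G.
Proof.
move=> tf bF bG FG v; apply: eq_inner => z.
have -> : '[z, F v] = '[adjoint F z, v] by rewrite (adjoint_swap (adjointP bF)).
have -> : '[z, G v] = '[adjoint G z, v] by rewrite (adjoint_swap (adjointP bG)).
suff -> : adjoint F z = adjoint G z by [].
apply/eqP; rewrite -subr_eq0; apply/eqP; apply: tf => k.
by rewrite innerDr innerNr -(adjointP bF) -(adjointP bG) FG subrr.
Qed.

(** [u v] is obtained by representing the functional [g k |-> <f k, v>].  The
    relation between the spans of [f] and [g] is described without finite sums,
    as the double annihilator of the pairs [(f k, g k)]; testing a related pair
    against itself shows that it preserves norms. *)
Lemma gram_unitary (f g : I -> H) : total_family f -> total_family g ->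
  (forall k l, '[f k, f l] = '[g k, g l]) ->
  exists2 u, unitary u & forall k, u (f k) = g k.
Proof.
move=> tf tg fg.
pose Gr s t := forall v w, (forall k, '[f k, v] = '[g k, w]) -> '[s, v] = '[t, w].
have Gr_fg k : Gr (f k) (g k) by move=> v w.
have Gr_sq s t : Gr s t -> sq s = sq t.
  move=> st; rewrite /sq (st s t)// => k.
  by rewrite innerC (st (f k) (g k)) -?innerC// => l.
have /choice[u hu] v : exists w, (forall k, '[g k, w] = '[f k, v]) /\ sq w <= sq v.
  have [|||||w [hw sw _]] := @riesz_relation _ H
    (fun t a => exists2 s, Gr s t & a = '[s, v]) (sq v).
  - exact: sq_ge0.
  - by exists 0; rewrite ?inner0l// => ? ? ?; rewrite !inner0l.
  - move=> t _ t' _ [s st ->] [s' st' ->]; exists (s + s'); last by rewrite innerDl.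
    by move=> a b ab; rewrite !innerDl (st _ _ ab) (st' _ _ ab).
  - move=> c t _ [s st ->]; exists (c *: s); last by rewrite innerZl.
    by move=> a b ab; rewrite !innerZl (st _ _ ab).
  - move=> t _ [s st ->]; apply: le_trans (cauchy_schwarz _ _) _.
    by rewrite (Gr_sq _ _ st) mulrC.
  by exists w; split=> // k; apply: hw; exists (f k).
have hg v k := proj1 (hu v) k.
have uniq v w : (forall k, '[g k, w] = '[f k, v]) -> u v = w.
  move=> h; apply/eqP; rewrite -subr_eq0; apply/eqP; apply: tg => k.
  by rewrite innerDr innerNr hg h subrr.
have lu : linear u.
  by move=> c v w; apply: uniq => k; rewrite !innerE !hg.
have bu : bounded_operator u by apply: bounded_of_sq_le => // v; apply: (hu v).2.
have uf k : u (f k) = g k by apply: uniq => l; rewrite fg.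
exists u => //.
have au := adjointP bu.
have gf k : adjoint u (g k) = f k.
  by apply: eq_inner => z; rewrite -au innerC hg -innerC.
have bid : bounded_operator (@idfun H) by exact: bounded_of_sq_le.
have ba := adjoint_bounded bu.
apply: (unitary_of_adjoint bu au).
  by apply: (total_ext tf (bounded_comp ba bu) bid) => k /=; rewrite uf gf.
by apply: (total_ext tg (bounded_comp bu ba) bid) => k /=; rewrite gf uf.
Qed.

End Total.
End Operators.

(** * Corners of a factor *)

Section Factor.
Variables (R : realType) (H : hilbertType R) (B : set (H -> H)).
Hypothesis factB : Defs.factor B.
Implicit Types (x y z w h k : H) (T S u e b : H -> H).

Local Notation "''[' x , y ]" := (inner H x y) : ring_scope.
Local Notation conj := Num.conj.
Local Notation i := ('i%C : R[i]).

Let vnB : von_neumann_algebra B := factB.1.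

Lemma factor_center T : B T -> commutant B T -> exists c : R[i], T = scalar_operator c.
Proof.
move=> BT cT; have [_ cB] := factB.
have : Defs.center B T by split.
by rewrite cB => -[c _ <-]; exists c.
Qed.

(** The closed span [K] of the vectors [b (e h)] is invariant under [B] and under
    its commutant, so the projection onto [K] is central in [B], hence a scalar;
    it fixes the nonzero range of [e], so this scalar is 1. *)
Lemma orbit_total e : B e -> e <> (fun=> 0) ->
  total_family (fun bh : {b | B b} * H => (sval bh.1) (e bh.2)).
Proof.
move=> Be e0.
pose L (s : H) := exists b h, B b /\ s = b (e h).
pose perp (P : H -> Prop) (w : H) := forall s, P s -> '[s, w] = 0.
pose K := perp (perp L).
have LK s : L s -> K s by move=> Ls t /(_ s Ls) h; rewrite innerC h rmorph0.
have perpK P w : perp P w -> forall c v, perp P v -> perp P (c *: w + v).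
  by move=> hw c v hv s Ps; rewrite !innerE hw// hv// mulr0 addr0.
have K0 : K 0 by move=> s _; rewrite inner0r.
have Kinv a a' : bounded_operator a -> bounded_operator a' -> is_adjoint a' a ->
    (forall s, L s -> L (a s)) -> (forall s, L s -> L (a' s)) -> forall s, K s -> K (a s).
  move=> ba ba' aa La La' s Ks t Lt; rewrite -aa; apply: Ks => r Lr.
  by rewrite -(adjoint_swap aa); apply: Lt; exact: La.
(* K is the double orthogonal complement of L; riesz_relation returns a point of K
   since it is orthogonal to everything that K is orthogonal to. *)
have projK v : exists w, K w /\ forall s, K s -> '[s, v - w] = 0.
  have [|||||w [hw _ wK]] := @riesz_relation _ H (fun s a => K s /\ a = '[s, v]) (sq v).
  - exact: sq_ge0.
  - by split; rewrite ?inner0l.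
  - move=> s _ t _ [Ks ->] [Kt ->]; rewrite innerDl; split=> //.
    by rewrite -[s]scale1r; apply: perpK.
  - move=> c s _ [Ks ->]; rewrite innerZl; split=> //.
    by rewrite -[X in K X]addr0; apply: perpK.
  - by move=> s _ [_ ->]; rewrite mulrC; exact: cauchy_schwarz.
  exists w; split.
    move=> u hu; rewrite innerC wK ?rmorph0// => s _ [Ks _].
    by rewrite innerC Ks ?rmorph0.
  by move=> s Ks; rewrite innerDr innerNr (hw s '[s, v])// subrr.
have /choice[p hp] := projK.
have puniq v w : K w -> (forall s, K s -> '[s, v - w] = 0) -> p v = w.
  move=> Kw hw; have [Kp hv] := hp v.
  have Kd : K (p v - w) by rewrite addrC -scaleN1r; apply: perpK.
  apply/eqP; rewrite -subr_eq0; apply/eqP; apply: inner_eq0.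
  have {2}-> : p v - w = (v - w) - (v - p v) by rewrite opprB [RHS]addrC addrA subrK.
  by rewrite innerDr innerNr hw// hv// subrr.
have lp : linear p.
  move=> c x y; have [Kx hx] := hp x; have [Ky hy] := hp y.
  apply: puniq; first exact: perpK.
  move=> s Ks; have -> : c *: x + y - (c *: p x + p y) = c *: (x - p x) + (y - p y).
    by rewrite scalerBr opprD addrACA.
  by rewrite innerDr innerZr hx// hy// mulr0 addr0.
have bp : bounded_operator p.
  apply: bounded_of_sq_le => // x; have [Kx hx] := hp x.
  have e1 : x = p x + (x - p x) by rewrite addrC subrK.
  by rewrite {2}e1 sqD hx//= mulr0 addr0 lerDl sq_ge0.
have pcomm a a' : bounded_operator a -> bounded_operator a' -> is_adjoint a' a ->
    (forall s, L s -> L (a s)) -> (forall s, L s -> L (a' s)) -> commutes p a.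
  move=> ba ba' aa La La' v; have [Kv hv] := hp v.
  apply: puniq; first exact: (Kinv a a').
  move=> s Ks; rewrite -(linB _ _ (bounded_lin ba)) -aa hv//.
  exact: (Kinv a' a ba' ba (adjoint_swap aa)).
have LB b : B b -> forall s, L s -> L (b s).
  move=> Bb _ [b' [h [Bb' ->]]]; exists (b \o b'), h; split=> //.
  exact: vna_comp.
have LC T : commutant B T -> forall s, L s -> L (T s).
  move=> /commutantP[bT hT] _ [b' [h [Bb' ->]]]; exists b', (T h); split=> //.
  by rewrite hT// hT.
have pB' : commutant B p.
  apply/commutantP; split=> // b Bb; have bb := vna_bounded vnB Bb.
  have Bb' := vna_adjoint vnB Bb.
  apply: (pcomm _ (adjoint b)) => //; try exact: LB.
    exact: adjoint_bounded.
  exact/adjoint_swap/adjointP.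
have pB : B p.
  apply/(vnaP vnB); split=> // T hT; apply: commutes_sym.
  have [bT _] := (commutantP _ _).1 hT; have hT' := commutant_adjoint vnB hT.
  apply: (pcomm _ (adjoint T)) => //; try exact: LC.
    exact: adjoint_bounded.
  exact/adjoint_swap/adjointP.
have [c pc] := factor_center pB pB'.
have [x ex0] : exists x, e x <> 0.
  apply: contrapT => h; apply: e0; apply/funext => x.
  by apply: contrapT => ?; apply: h; exists x.
have pe : p (e x) = e x.
  apply: puniq; last by move=> s _; rewrite subrr inner0r.
  by apply: LK; exists idfun, x; split=> //; exact: vna_id.
have c1 : c = 1.
  apply/eqP; rewrite -subr_eq0; apply/negPn/negP => cn; apply: ex0.
  apply: (scalerI cn); rewrite scaler0 scalerBl scale1r.
  by move: pe; rewrite pc /scalar_operator => ->; rewrite subrr.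
move=> w hw; apply: inner_eq0.
have : K w by have [] := hp w; rewrite pc c1 /scalar_operator scale1r.
by apply=> _ [b [h [Bb ->]]]; exact: (hw (exist _ b Bb, h)).
Qed.

(** The corner form of [(e B e)' = B' e].  With [b'^* b] compressed to [e B e], the
    unitary [u] can be moved across it, so [b (e h) |-> b (u (e h))] preserves
    inner products.  The last clause places [y] in any von Neumann algebra that
    contains [B] and [u]. *)
Lemma unitary_lift e u : B e -> projection e -> e <> (fun=> 0) ->
  unitary u -> commutes u e -> (forall b, B b -> commutes u (e \o b \o e)) ->
  exists y : H -> H, [/\ unitary y, commutant B y, y \o e = u \o e &
    forall T, commutant B T -> commutes T u -> commutes T y].
Proof.
move=> Be pe e0 uu ue ub.
have bu : bounded_operator u by case: uu.
pose f (bh : {b | B b} * H) := (sval bh.1) (e bh.2).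
have tf : total_family f := orbit_total Be e0.
pose g (bh : {b | B b} * H) := (sval bh.1) (u (e bh.2)).
have se := projection_sa pe.
have ue' h : e (adjoint u h) = adjoint u (e h).
  by rewrite -{2}(unitaryVK uu h) -ue unitaryK.
have tg : total_family g.
  move=> w hw; apply: tf => -[b h]; rewrite /f /=.
  by have := hw (b, adjoint u h); rewrite /g /= ue' unitaryVK.
have gram p q : '[f p, f q] = '[g p, g q].
  case: p q => [[b Bb] h] [[b' Bb'] h']; rewrite /f /g /=.
  have ab' := adjointP (vna_bounded vnB Bb').
  have Bbb : B (adjoint b' \o b) by apply: vna_comp => //; exact: vna_adjoint.
  have adj v w : '[v, b' w] = '[adjoint b' v, w] by rewrite (adjoint_swap ab').
  rewrite !adj [u (e h')]ue -!se.
  have := ub _ Bbb (e h); rewrite /= -ue !projection_idem// => <-.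
  by rewrite unitary_inner.
have [y uy yf] := gram_unitary tf tg gram.
have by_ : bounded_operator y by case: uy.
have yB b : B b -> commutes y b.
  move=> Bb; have bb := vna_bounded vnB Bb.
  apply: (total_ext tf (bounded_comp by_ bb) (bounded_comp bb by_)) => -[[b' Bb'] h] /=.
  have := yf (exist _ _ (vna_comp vnB Bb Bb'), h); rewrite /f /g /= => ->.
  by have := yf (exist _ b' Bb', h); rewrite /f /g /= => ->.
have ye : y \o e = u \o e.
  by apply/funext => h /=; have := yf (exist _ _ (vna_id vnB), h).
exists y; split=> //; first exact/commutantP.
move=> T /commutantP[bT hT] Tu.
apply: (total_ext tf (bounded_comp bT by_) (bounded_comp by_ bT)) => -[[b Bb] h] /=.
have := yf (exist _ b Bb, h); rewrite /f /g /= => ->.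
rewrite (hT _ Bb) (hT _ Bb) (hT _ Be).
have := yf (exist _ b Bb, T h); rewrite /f /g /= => ->.
by rewrite Tu (hT _ Be).
Qed.

Lemma corner_sa e a : projection e -> bounded_operator a -> is_adjoint a a ->
  bounded_operator (e \o a \o e) /\ is_adjoint (e \o a \o e) (e \o a \o e).
Proof.
move=> pe ba sa; have [be _ _] := pe; have se := projection_sa pe.
split; first by apply: bounded_comp => //; exact: bounded_comp.
by move=> x y /=; rewrite se sa se.
Qed.

(** The Cayley transform of an element of the corner acts as -1 off the corner, so
    it is determined by its restriction [u \o e]. *)
Lemma commutes_cayley_corner e a u S : projection e -> bounded_operator a ->
  unitary u -> (forall h, (e \o a \o e) h = 0 -> u h = - h) ->
  linear S -> commutes S e -> commutes S (u \o e) -> commutes S u.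
Proof.
move=> pe ba uu u0 lS Se Sue h.
have lu : linear u by case: uu => /bounded_lin.
have [be _ _] := pe; have le := bounded_lin be; have la := bounded_lin ba.
have uE k : u k = u (e k) - (k - e k).
  rewrite -{1}(subrK (e k) k) (linD _ _ lu) addrC (u0 (k - e k))//=.
  by rewrite (linB _ _ le) projection_idem// subrr (lin0 la) (lin0 le).
rewrite uE (linB _ _ lS) (linB _ _ lS) [S (u (e h))]Sue/= Se.
by rewrite [RHS]uE.
Qed.

(** This stands for [e B e = C e].  The Cayley transform [u] of a self-adjoint
    element of the corner commutes with the abelian [e B e], so it lifts to some
    [y] commuting with [B]; since [u] is in [B], so is [y], which is then a scalar
    because [B] is a factor.  Thus [u e] is a multiple of [e]. *)
Lemma commutes_corner e S : abelian_projection B e -> e <> (fun=> 0) ->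
  linear S -> commutes S e -> forall b, B b -> commutes S (e \o b \o e).
Proof.
move=> [Be pe ab] e0 lS Se.
have [be _ _] := pe; have le := bounded_lin be.
apply: (vna_ind vnB) => [b Bb sb|b1 b2 B1 B2 h1 h2 x /=]; last first.
  rewrite !(linD _ _ le) !(linZ _ _ le) (linD _ _ lS) (linZ _ _ lS).
  by have /= -> := h1 x; have /= -> := h2 x.
have bb := vna_bounded vnB Bb.
have [bx sx] := corner_sa pe bb sb.
set x := e \o b \o e in bx sx *.
have Bx : B x by apply: vna_comp => //; exact: vna_comp.
have [u [uu ux u0]] := cayley bx sx.
have bu : bounded_operator u by case: uu.
have ue : commutes u e.
  by apply/commutes_sym/ux => // h; rewrite /x /= !projection_idem.
have ub b' : B b' -> commutes u (e \o b' \o e).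
  move=> Bb'; apply/commutes_sym/ux.
    by apply: bounded_lin; apply: (vna_bounded vnB); apply: vna_comp => //; exact: vna_comp.
  by move=> h; have := ab _ _ Bb' Bb => /funeqP/(_ h).
have [y [uy yB ye yT]] := unitary_lift Be pe e0 uu ue ub.
have By : B y.
  apply/(vnaP vnB); split; first by case: uy.
  move=> T hT; apply: yT => //; have [bT cT] := (commutantP _ _).1 hT.
  by apply/ux; [exact: bounded_lin | exact: cT].
have [c yc] := factor_center By yB.
apply/ux => //; apply: (commutes_cayley_corner pe bb uu u0) => // h.
by rewrite -ye yc /scalar_operator /= (linZ _ _ lS) Se.
Qed.

(** The coefficients [<m b e h, b' e k>] only see [e b'^* m b e], which lies in the
    corner [e M e], and the vectors [b e h] are total. *)
Lemma commutes_of_corner e (M : set (H -> H)) S : von_neumann_algebra M -> B `<=` M ->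
  B e -> projection e -> e <> (fun=> 0) ->
  commutant B S -> (forall m, M m -> commutes S (e \o m \o e)) ->
  forall m, M m -> commutes S m.
Proof.
move=> vnM BM Be pe e0 /commutantP[bS SB] Se m Mm.
have tf := orbit_total Be e0.
have bm := vna_bounded vnM Mm.
apply: (total_ext tf (bounded_comp bS bm) (bounded_comp bm bS)) => -[[b Bb] h] /=.
apply/eqP; rewrite -subr_eq0; apply/eqP; apply: tf => -[[b' Bb'] k] /=.
have ab' := adjointP (vna_bounded vnB Bb').
have Bb'' := vna_adjoint vnB Bb'.
rewrite innerDr innerNr !ab' !(projection_sa pe).
have -> : e (adjoint b' (S (m (b (e h))))) = S (e (adjoint b' (m (b (e h))))).
  by rewrite (SB _ Be) (SB _ Bb'').
have Mc : M (adjoint b' \o m \o b).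
  by apply: vna_comp => //; [apply: vna_comp => //; apply: BM | apply: BM].
have /= -> := Se _ Mc h.
by rewrite (SB _ Bb) (SB _ Be) subrr.
Qed.

End Factor.

(** * The unitary normaliser *)

Section UnitaryNormaliser.
Variables (R : realType) (H : hilbertType R) (M B : set (H -> H)).
Hypotheses (vnM : von_neumann_algebra M) (factB : Defs.factor B) (BM : B `<=` M).
Implicit Types (u T : H -> H).

Let vnB : von_neumann_algebra B := factB.1.

Lemma unitary_normaliser_in u : B u -> unitary u -> unitary_normaliser M B u.
Proof.
move=> Bu uu; split=> //; first exact: BM.
have Bu' := vna_adjoint vnB Bu.
apply/seteqP; split=> [_ [b Bb <-]|b Bb].
  by apply: (vna_comp vnB) => //; exact: (vna_comp vnB).
exists (adjoint u \o b \o u).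
  by apply: (vna_comp vnB) => //; exact: (vna_comp vnB).
by apply/funext => x /=; rewrite !(unitaryVK uu).
Qed.

Lemma unitary_normaliser_commutant u : M u -> commutant B u -> unitary u ->
  unitary_normaliser M B u.
Proof.
move=> Mu /commutantP[_ uB] uu; split=> //.
have ub b : B b -> u \o b \o adjoint u = b.
  by move=> Bb; apply/funext => x /=; rewrite (uB _ Bb) (unitaryVK uu).
apply/seteqP; split=> [_ [b Bb <-]|b Bb]; first by rewrite ub.
by exists b => //; exact: ub.
Qed.

(** Unitaries of [B] give commutation with [B]; unitaries of [M] commuting with [B],
    obtained by lifting Cayley transforms from [e M e], give commutation with
    [e M e]. *)
Lemma commutes_of_unitary_normaliser e T : abelian_projection B e -> e <> (fun=> 0) ->
  bounded_operator T -> (forall u, unitary_normaliser M B u -> commutes T u) ->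
  forall m, M m -> commutes T m.
Proof.
move=> abe e0 bT hT; have [Be pe _] := abe; have lT := bounded_lin bT.
have TB : forall b, B b -> commutes T b.
  apply: (vna_ind vnB) => [b Bb sb|b1 b2 _ _ h1 h2 x]; last first.
    by rewrite (linD _ _ lT) (linZ _ _ lT) h1 h2.
  have [u [uu ux _]] := cayley (vna_bounded vnB Bb) sb.
  apply/(ux _ lT); apply: hT; apply: unitary_normaliser_in => //.
  apply/(vnaP vnB); split; first by case: uu.
  by move=> S /commutantP[bS hS]; apply/ux; [exact: bounded_lin | exact: hS].
apply: (commutes_of_corner factB vnM BM Be pe e0); first exact/commutantP.
have [be _ _] := pe; have le := bounded_lin be.
apply: (vna_ind vnM) => [m Mm sm|m1 m2 _ _ h1 h2 x /=]; last first.
  rewrite !(linD _ _ le) !(linZ _ _ le) (linD _ _ lT) (linZ _ _ lT).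
  by have /= -> := h1 x; have /= -> := h2 x.
have bm := vna_bounded vnM Mm.
have [bx sx] := corner_sa pe bm sm.
have [u [uu ux u0]] := cayley bx sx.
have bu : bounded_operator u by case: uu.
have ue : commutes u e.
  by apply/commutes_sym/ux => // h; rewrite /= !projection_idem.
have ub b : B b -> commutes u (e \o b \o e).
  by apply: (commutes_corner factB abe e0 (bounded_lin bu) ue).
have [y [uy yB ye yT]] := unitary_lift factB Be pe e0 uu ue ub.
have My : M y.
  apply/(vnaP vnM); split; first by case: uy.
  move=> S /commutantP[bS hS]; apply: yT.
    by apply/commutantP; split=> // b /BM; exact: hS.
  apply/ux; first exact: bounded_lin.
  by move=> h /=; rewrite (hS _ (BM Be)) (hS _ Mm) (hS _ (BM Be)).
have Ty := hT _ (unitary_normaliser_commutant My yB uy).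
apply/(ux _ lT); apply: (commutes_cayley_corner pe bm uu u0) => //; first exact: TB.
by move=> h; rewrite -ye /= Ty (TB _ Be).
Qed.

End UnitaryNormaliser.

(** The unit of [B] is a nonzero central projection: otherwise [H] is trivial and
    the unit would be finite. *)
Lemma type_I_infty_abelian_projection (R : realType) (H : hilbertType R)
    (B : set (H -> H)) : type_I_infty_factor B ->
  exists2 e, abelian_projection B e & e <> (fun=> 0).
Proof.
move=> [[vnB cB] tB nf].
have cid : Defs.center B idfun.
  by rewrite cB; exists 1 => //; apply/funext => x; rewrite /scalar_operator scale1r.
have pid : projection (@idfun H).
  split=> //; first exact: bounded_of_sq_le.
  exact: adjoint_unique.
have id0 : @idfun H <> (fun=> 0).
  move=> h; have H0 (x : H) : x = 0 by have /funeqP/(_ x) := h.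
  by apply: nf => q _ _ _ _; apply/funext => x; rewrite [LHS]H0 [RHS]H0.
by have [e [abe e0 _]] := tB _ cid pid id0; exists e.
Qed.

Theorem theorem3p17 (R : realType) (H : hilbertType R) (M B : set (H -> H))
  (hM : type_I_infty_factor M) (hB : type_I_infty_factor B)
  (hBM : B `<=` M) (hreg : regular M B) :
  unitarily_regular M B.
Proof.
have [[vnM _] _ _] := hM; have [facB _ _] := hB.
have [e abe e0] := type_I_infty_abelian_projection hB.
apply/seteqP; split=> [m []//|m Mm]; split=> // N vnN NM UN.
apply/(vnaP vnN); split; first exact: (vna_bounded vnM).
move=> T /commutantP[bT hT].
by apply: (commutes_of_unitary_normaliser vnM facB hBM abe e0 bT) => // u /UN; exact: hT.
Qed.
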